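(* Let $H$ be a real Hilbert space and $\{b,a_1,a_2,\dots,a_m\}\subset H$. Then exactly one of the following two systems has a solution: System 1: $\sum_{i=1}^m y_i a_i=b$ for some scalars $y_i\ge 0$ ($i=1,\dots,m$). System 2: There exists $x\in H$ such that $\langle a_i,x\rangle\le 0$ for $i=1,\dots,m$ and $\langle b,x\rangle>0$.
   Context: All linear spaces are real; $\langle\cdot,\cdot\rangle$ is the inner product of $H$. *)

(* Defs.v *)
From mathcomp Require Import all_boot all_order all_algebra.
From mathcomp Require Import all_classical all_reals all_analysis.

Set Implicit Arguments.
Unset Strict Implicit.
Unset Printing Implicit Defensive.

Import Order.TTheory GRing.Theory Num.Theory.
Import numFieldNormedType.Exports.

Local Open Scope ring_scope.

(* A real Hilbert space is a Banach space [H] over [R : realType] with a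
   symmetric positive definite bilinear form [dot : {dot H for idfun}] that
   induces the norm of [H]. *)
Definition induces_norm (R : realType) (H : completeNormedModType R)
    (dot : {dot H for idfun}) : Prop :=
  forall x : H, `|x| = Num.sqrt (dot x x).

Definition system1 (R : realType) (H : completeNormedModType R)
    (m : nat) (a : 'I_m -> H) (b : H) : Prop :=
  exists y : 'I_m -> R,
    (forall i, 0 <= y i) /\ \sum_(i < m) y i *: a i = b.

Definition system2 (R : realType) (H : completeNormedModType R)
    (dot : {dot H for idfun}) (m : nat) (a : 'I_m -> H) (b : H) : Prop :=
  exists x : H, (forall i, dot (a i) x <= 0) /\ 0 < dot b x.

(* Main.v *)
Require Import Defs.
From mathcomp Require Import all_boot all_order all_algebra.
From mathcomp Require Import all_classical all_reals all_analysis.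

(** At most one of the two systems is solvable: pairing [b = \sum_i y i *: a i]
    with a solution [x] of the second system would make a sum of nonpositive
    reals positive ([cone_dot_le0]).

    At least one is solvable by a purely algebraic induction on [m]
    ([farkas_dichotomy]).  Without generators, either [b] is the empty sum or
    [x := b] works.  Otherwise single out one generator [a0] and apply the
    induction hypothesis to the remaining ones.  It yields either nonnegative coefficients for [b], in which case
    [a0] gets coefficient 0, or a vector [x] separating [b] from the remaining
    [a i].  The vector [x] is good enough if [dot a0 x <= 0].  Otherwise
    project all vectors along [a0] onto the hyperplane orthogonal to [x], by
    [v |-> v - (dot v x / dot a0 x) *: a0], and apply the induction hypothesis
    once more, to the projected vectors.
    - Nonnegative coefficients [y] for the projection of [b] give coefficients
      for [b] itself; the coefficient that [a0] receives is
      [(dot b x - \sum_i y i * dot (a i) x) / dot a0 x], which is nonnegative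
      because [x] separates [b] from the remaining [a i].
    - A vector [z] separating the projected vectors is moved along [x] to a
      vector orthogonal to [a0].  Such a correction is adjoint to the
      projection, hence the corrected vector pairs with the original vectors
      as [z] does with the projected ones, and it solves the second system. *)

Set Implicit Arguments.
Unset Strict Implicit.
Unset Printing Implicit Defensive.

Section Farkas.
Import Order.TTheory GRing.Theory Num.Theory.
Local Open Scope ring_scope.

Lemma cone_dot_le0 (R : realFieldType) (V : lmodType R)
    (dot : {dot V for idfun}) (m : nat) (a : 'I_m -> V) (y : 'I_m -> R)
    (x : V) :
  (forall i, 0 <= y i) -> (forall i, dot (a i) x <= 0) ->
  dot (\sum_i y i *: a i) x <= 0.
Proof.
move=> y_ge0 ax_le0; rewrite linear_sumlz; apply: sumr_le0 => i _.
by rewrite linearZl_LR /= mulr_ge0_le0.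
Qed.

Lemma cone_extend (R : realFieldType) (V : lmodType R) (m : nat)
    (a : 'I_m.+1 -> V) (b : V) (c : R) (y : 'I_m -> R) :
  0 <= c -> (forall i, 0 <= y i) ->
  c *: a ord0 + \sum_i y i *: a (lift ord0 i) = b ->
  exists z : 'I_m.+1 -> R, (forall i, 0 <= z i) /\ \sum_i z i *: a i = b.
Proof.
move=> c_ge0 y_ge0 <-.
exists (fun i => if unlift ord0 i is Some j then y j else c); split=> [i|].
  by case: unliftP.
rewrite big_ord_recl unlift_none; congr (_ + _).
by apply: eq_bigr => i _; rewrite liftK.
Qed.

(** Along [u] onto the hyperplane orthogonal to [x]. *)
Definition oblique_proj (R : realFieldType) (V : lmodType R)
    (dot : {dot V for idfun}) (u x v : V) : V :=
  v - (dot v x / dot u x) *: u.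

(** Exchanging the roles of [u] and [x] gives the adjoint: both sides equal
    [dot v z - dot v x * dot u z / dot u x]. *)
Lemma dot_oblique_proj (R : realFieldType) (V : lmodType R)
    (dot : {dot V for idfun}) (u x v z : V) :
  dot (oblique_proj dot u x v) z = dot v (z - (dot u z / dot u x) *: x).
Proof.
rewrite linearBl linearZl_LR linearBr linearZr_LR /=.
by rewrite mulrAC [dot u z / _ * _]mulrAC [dot v x * _]mulrC.
Qed.

Lemma oblique_proj_self (R : realFieldType) (V : lmodType R)
    (dot : {dot V for idfun}) (u x : V) :
  dot u x != 0 -> oblique_proj dot u x u = 0.
Proof. by move=> ux_neq0; rewrite /oblique_proj divff // scale1r subrr. Qed.

Lemma farkas_dichotomy (R : realFieldType) (V : lmodType R)
    (dot : {dot V for idfun}) (m : nat) (a : 'I_m -> V) (b : V) :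
  (exists y : 'I_m -> R, (forall i, 0 <= y i) /\ \sum_i y i *: a i = b) \/
  (exists x : V, (forall i, dot (a i) x <= 0) /\ 0 < dot b x).
Proof.
elim: m a b => [|m IHm] a b.
  have [->|b_neq0] := eqVneq b 0.
    by left; exists (fun=> 0); rewrite big_ord0; split=> [[]|].
  by right; exists b; split=> [[]|] //; apply: neq0_dnorm_gt0.
have [[y [y_ge0 yab]]|[x [ax_le0 bx_gt0]]] := IHm (fun i => a (lift ord0 i)) b.
  by left; apply: (cone_extend (lexx 0) y_ge0); rewrite scale0r add0r.
have [a0x_le0|a0x_gt0] := leP (dot (a ord0) x) 0.
  by right; exists x; split=> // i; case: (unliftP ord0 i) => [j|] ->.
have a0x_neq0 : dot (a ord0) x != 0 by rewrite gt_eqF.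
pose p := oblique_proj dot (a ord0) x.
have [[y [y_ge0 ypab]]|[z [paz_le0 pbz_gt0]]] :=
  IHm (fun i => p (a (lift ord0 i))) (p b).
  left; pose s := \sum_i y i *: a (lift ord0 i).
  have sx_le0 : dot s x <= 0 by apply: cone_dot_le0.
  apply: (@cone_extend _ _ _ _ _ ((dot b x - dot s x) / dot (a ord0) x) y) => //.
    by rewrite divr_ge0 ?(ltW a0x_gt0) // subr_ge0 (le_trans sx_le0) ?ltW.
  have ps_pb : p s = p b.
    rewrite -ypab /p /oblique_proj linear_sumlz mulr_suml scaler_suml -sumrB.
    by apply: eq_bigr => i _; rewrite linearZl_LR /= scalerBr scalerA mulrA.
  move/eqP: ps_pb; rewrite /p /oblique_proj subr_eq => /eqP ps_pb.
  rewrite -/s mulrBl scalerBl [X in _ + X]ps_pb.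
  by rewrite addrACA addNr addr0 addrC subrK.
right; exists (z - (dot (a ord0) z / dot (a ord0) x) *: x).
split; last by rewrite -dot_oblique_proj.
move=> i; rewrite -dot_oblique_proj.
case: (unliftP ord0 i) => [j|] -> //.
by rewrite oblique_proj_self // linear0l.
Qed.

End Farkas.

Theorem theorem3p2 (R : realType) (H : completeNormedModType R)
    (dot : {dot H for idfun}%R) (dot_norm : induces_norm dot)
    (m : nat) (a : 'I_m -> H) (b : H) :
  (system1 a b /\ ~ system2 dot a b) \/ (~ system1 a b /\ system2 dot a b).
Proof.
have excl : system1 a b -> ~ system2 dot a b.
  move=> [y [y_ge0 <-]] [x [ax_le0]].
  by rewrite Order.TotalTheory.ltNge cone_dot_le0.
have [sol1|sol2] := farkas_dichotomy dot a b.
  by left; split=> //; apply: excl.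
by right; split=> // /excl.
Qed.
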